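(* Let $1<p<\infty$. In the space $\ell^p$ there exists (i) a (Schauder) basis $(u_n)_n$ which is $p$-Hilbertian but not $p$-Besselian (hence not $p$-Riesz); (ii) a (Schauder) basis $(v_n)_n$ which is $p$-Besselian but not $p$-Hilbertian; (iii) a (Schauder) basis which is neither $p$-Hilbertian nor $p$-Besselian.
   Context: $c_{00}$ is the space of finitely supported complex sequences. A sequence $(g_j)_j$ in a Banach space is $p$-Hilbertian if there is a constant $C$ such that $\|\sum_j\alpha_jg_j\|\le C\|\alpha\|_p$ for all $\alpha=(\alpha_j)_j\in c_{00}$; it is $p$-Besselian if there is a constant $c>0$ such that $\|\sum_j\alpha_jg_j\|\ge c\|\alpha\|_p$ for all $\alpha\in c_{00}$; it is $p$-Riesz if it is both $p$-Hilbertian and $p$-Besselian. A Schauder basis of a Banach space $X$ is a sequence $(x_n)_n$ such that every $x\in X$ has a unique norm-convergent expansion $x=\sum_n\alpha_nx_n$ with complex scalars. *)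

(* Defs.v *)
From HB Require Import structures.
From mathcomp Require Import all_boot all_order all_algebra.
From mathcomp Require Import all_classical all_reals all_analysis.
From mathcomp Require Import complex.

Set Implicit Arguments.
Unset Strict Implicit.
Unset Printing Implicit Defensive.

Import Order.TTheory GRing.Theory Num.Theory.
Import numFieldNormedType.Exports.
Import ComplexField.Normc.

Local Open Scope classical_set_scope.
Local Open Scope complex_scope.
Local Open Scope ring_scope.

Section lpnorm.
Context {R : realType}.
Implicit Types (p : R) (a : nat -> R[i]).

(* (sum_n |a_n|^p)^(1/p), equal to +oo when the series diverges. *)
Definition lpnorm p a : \bar R :=
  'N[@counting nat R]_(p%:E)[EFin \o (@normc R \o a)]%E.

End lpnorm.

Section real_sequences.
Context {R : realType}.
Variable p : R.
Hypothesis p1 : 1 <= p.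
Implicit Types f g : nat -> R.

Let L f := 'N[@counting nat R]_(p%:E)[EFin \o f]%E.

Let p_gt0 : 0 < p. Proof. exact: lt_le_trans p1. Qed.

Lemma lpN_series f : L f = ((\sum_(k <oo) (`|f k| `^ p)%:E) `^ p^-1)%E.
Proof. by rewrite /L Lnorm_counting. Qed.

Lemma lpN_ge0 f : (0 <= L f)%E. Proof. exact: Lnorm_ge0. Qed.

Lemma lpN_le f g : (forall k, `|f k| <= `|g k|) -> (L f <= L g)%E.
Proof.
move=> fg; rewrite !lpN_series; apply: gt0_ler_poweR.
- by rewrite invr_ge0 ltW.
- by rewrite in_itv/= leey andbT; apply: nneseries_ge0 => *; rewrite lee_fin powR_ge0.
- by rewrite in_itv/= leey andbT; apply: nneseries_ge0 => *; rewrite lee_fin powR_ge0.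
apply: lee_nneseries => k *; first by rewrite lee_fin powR_ge0.
by rewrite lee_fin ge0_ler_powR// ?ltW// nnegrE.
Qed.

Lemma lpND f g : (L (f \+ g)%R <= L f + L g)%E.
Proof. by apply: eminkowski. Qed.

Lemma lpN_pow f : (L f `^ p = \sum_(k <oo) (`|f k| `^ p)%:E)%E.
Proof.
rewrite lpN_series -poweRrM mulVf ?gt_eqF// poweRe1//.
by apply: nneseries_ge0 => *; rewrite lee_fin powR_ge0.
Qed.

Lemma lpNZ c f : L (fun k => c * f k) = (`|c|%:E * L f)%E.
Proof.
rewrite !lpN_series.
under eq_eseriesr do rewrite normrM powRM// EFinM.
rewrite nneseriesZl; last first.
  by move=> k _ /=; rewrite lee_fin powR_ge0.
rewrite poweRM ?lee_fin ?powR_ge0//; last first.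
  by apply: nneseries_ge0 => *; rewrite lee_fin powR_ge0.
by rewrite poweR_EFin -powRrM mulfV ?gt_eqF// powRr1.
Qed.

Lemma lpN_ub f (M : R) : 0 <= M ->
  (forall N, (\sum_(0 <= k < N) `|f k| `^ p) <= M `^ p) -> (L f <= M%:E)%E.
Proof.
move=> M0 fM.
have : (\sum_(k <oo) (`|f k| `^ p)%:E <= (M `^ p)%:E)%E.
  apply: lime_le.
    by apply: is_cvg_nneseries => *; rewrite lee_fin powR_ge0.
  by apply: nearW => N; rewrite sumEFin lee_fin.
rewrite lpN_series => H.
have -> : M%:E = ((M `^ p)%:E `^ p^-1)%E.
  by rewrite poweR_EFin -powRrM mulfV ?gt_eqF// powRr1.
apply: gt0_ler_poweR => //.
- by rewrite invr_ge0 ltW.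
- by rewrite in_itv/= leey andbT; apply: nneseries_ge0 => *; rewrite lee_fin powR_ge0.
- by rewrite in_itv/= leey andbT lee_fin powR_ge0.
Qed.

Lemma lpN_partial f N : ((\sum_(0 <= k < N) `|f k| `^ p)%:E <= L f `^ p)%E.
Proof.
rewrite lpN_pow -sumEFin; apply: nneseries_lim_ge => *.
by rewrite lee_fin powR_ge0.
Qed.

Lemma lpN_coord f k : (`|f k|%:E <= L f)%E.
Proof.
have [->|Lf] := eqVneq (L f) +oo%E; first by rewrite leey.
have Lfin : L f \is a fin_num.
  by rewrite fin_numE Lf andbT gt_eqF// (lt_le_trans _ (lpN_ge0 f)).
rewrite -(fineK Lfin) lee_fin leNgt; apply/negP => lt.
have := lpN_partial f k.+1.
rewrite -(fineK Lfin) poweR_EFin lee_fin; apply/negP; rewrite -ltNge.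
rewrite big_nat_recr//= ltr_wpDl//; first by apply: sumr_ge0 => *; exact: powR_ge0.
by rewrite gt0_ltr_powR// ?nnegrE// fine_ge0// lpN_ge0.
Qed.

Lemma lpN_trunc_lt f N : (L (fun k => if (k < N)%N then f k else 0%R) < +oo)%E.
Proof.
set g := fun k => _.
pose S := \sum_(0 <= k < N) `|g k| `^ p.
have S0 : 0 <= S by apply: sumr_ge0 => *; rewrite powR_ge0.
apply: (@le_lt_trans _ _ ((S `^ p^-1)%:E)); last by rewrite ltry.
apply: lpN_ub; first exact: powR_ge0.
move=> n; rewrite -powRrM mulVf ?gt_eqF// powRr1//.
have [nN|Nn] := leqP n N.
  by rewrite /S (big_cat_nat (leq0n n) nN)//= lerDl sumr_ge0// => *; rewrite powR_ge0.
rewrite (big_cat_nat (leq0n N) (ltnW Nn))//= -/S gerDl big_nat_cond big1// => k.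
by rewrite andbT /g => /andP[Nk _]; rewrite ltnNge Nk/= normr0 powR0// gt_eqF.
Qed.

Lemma lpN_ub_trunc f (M : R) : 0 <= M ->
  (forall N, (L (fun k => if (k < N)%N then f k else 0%R) <= M%:E)%E) ->
  (L f <= M%:E)%E.
Proof.
move=> M0 fM; apply: lpN_ub => // N.
set g := fun k => if (k < N)%N then f k else 0.
rewrite (_ : \sum_(0 <= k < N) _ = \sum_(0 <= k < N) `|g k| `^ p); last first.
  by apply: eq_big_nat => k /andP[_ kN]; rewrite /g kN.
rewrite -lee_fin (le_trans (lpN_partial g N))// -poweR_EFin.
apply: gt0_ler_poweR; rewrite ?in_itv/= ?leey ?andbT ?lpN_ge0 ?lee_fin//.
- exact: ltW.
- exact: fM.
Qed.

End real_sequences.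

Section lp_space.
Context {R : realType}.
Variable p : R.
Hypothesis p1 : 1 <= p.
Implicit Types a b : nat -> R[i].

Lemma normc_ge0 (z : R[i]) : 0 <= normc z.
Proof. by case: z => x y; exact: sqrtr_ge0. Qed.

Lemma normc_norm (z : R[i]) : `|z| = (normc z)%:C.
Proof. by case: z. Qed.

Lemma normcD (z w : R[i]) : normc (z + w) <= normc z + normc w.
Proof. exact: le_normcD. Qed.

Lemma lpnorm_ge0 a : (0 <= lpnorm p a)%E. Proof. exact: Lnorm_ge0. Qed.

Lemma lpnormD a b : (lpnorm p (a + b)%R <= lpnorm p a + lpnorm p b)%E.
Proof.
apply: le_trans (lpND p1 _ _); apply: lpN_le => // k /=.
by rewrite !ger0_norm ?addr_ge0 ?normc_ge0//; exact: normcD.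
Qed.

Lemma lpnormZ (c : R[i]) a : lpnorm p (c *: a)%R = ((normc c)%:E * lpnorm p a)%E.
Proof.
rewrite -[normc c]ger0_norm ?normc_ge0// -(lpNZ p1 (normc c) (@normc R \o a)).
by congr Lnorm; apply/funext => k /=; rewrite normcM.
Qed.

Lemma lpnorm_coord a k : ((normc (a k))%:E <= lpnorm p a)%E.
Proof.
rewrite -[normc _]ger0_norm ?normc_ge0//.
exact: (lpN_coord p1 (@normc R \o a) k).
Qed.

Lemma lpnorm_c0 : lpnorm p (0 : nat -> R[i])%R = 0%E.
Proof. by rewrite -(scale0r (0 : nat -> R[i])) lpnormZ normc0 mul0e. Qed.

Definition lp_pred : {pred (nat -> R[i])} := fun a => (lpnorm p a < +oo)%E.

Lemma lp_submod_closed : submod_closed lp_pred.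
Proof.
split=> [|c a b]; first by rewrite unfold_in/= lpnorm_c0.
rewrite !unfold_in/= => fa fb; apply: le_lt_trans (lpnormD _ _) _.
by rewrite lpnormZ lte_add_pinfty// lte_mul_pinfty// lee_fin normc_ge0.
Qed.

HB.instance Definition _ :=
  GRing.isSubmodClosed.Build R[i] (nat -> R[i]) lp_pred lp_submod_closed.

(* The space l^p. The unused argument is what lets the linear and normed
   structures, which need 1 <= p, be inferred from the type. *)
Record lp (h : 1 <= p) := Lp { lpseq :> nat -> R[i]; lpP : lpseq \in lp_pred }.

HB.instance Definition _ := [isSub of lp p1 for @lpseq p1].
HB.instance Definition _ := [Choice of lp p1 by <:].
HB.instance Definition _ := [SubChoice_isSubLmodule of lp p1 by <:].

Implicit Types x y : lp p1.

(* Norms of normed modules over R[i] take their values in R[i]. *)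
Definition lp_norm x : R[i] := (fine (lpnorm p x))%:C.

Lemma lpnorm_fin x : lpnorm p x \is a fin_num.
Proof. by rewrite ge0_fin_numE ?lpnorm_ge0//; exact: (lpP x). Qed.

Lemma lp_normD x y : lp_norm (x + y) <= lp_norm x + lp_norm y.
Proof.
rewrite -rmorphD lecR -fineD ?lpnorm_fin// fine_le ?lpnorm_fin//.
  by rewrite fin_numD !lpnorm_fin.
exact: lpnormD.
Qed.

Lemma lp_normZ (c : R[i]) x : lp_norm (c *: x) = `|c| * lp_norm x.
Proof.
by rewrite normc_norm -rmorphM /lp_norm/= lpnormZ fineM// lpnorm_fin.
Qed.

Lemma lp_norm_eq0 x : lp_norm x = 0 -> x = 0.
Proof.
move=> /complexI x0; apply/val_inj/funext => k /=; apply: eq0_normc.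
apply/eqP; rewrite eq_le normc_ge0 andbT -lee_fin.
by rewrite (le_trans (lpnorm_coord x k))// -(fineK (lpnorm_fin x)) x0.
Qed.

HB.instance Definition _ :=
  Lmodule_isNormed.Build R[i] (lp p1) lp_normD lp_normZ lp_norm_eq0.

Lemma lp_normE x : `|x| = (fine (lpnorm p x))%:C. Proof. by []. Qed.

Lemma lp_ballE x y (e : R) : ball x e%:C y = (lpnorm p (x - y)%R < e%:E)%E :> Prop.
Proof.
rewrite -ball_normE /ball_/= lp_normE ltcR -lte_fin.
by rewrite (fineK (lpnorm_fin (x - y))).
Qed.

Lemma normc_le_ReIm (z : R[i]) : normc z <= `|complex.Re z| + `|complex.Im z|.
Proof.
case: z => u v /=; rewrite -(@ler_pXn2r _ 2)// ?nnegrE ?sqrtr_ge0 ?addr_ge0//.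
rewrite sqr_sqrtr ?addr_ge0 ?sqr_ge0// sqrrD !real_normK ?num_real//.
by rewrite -addrA lerD2l lerDr mulrn_wge0// mulr_ge0.
Qed.

Lemma Re_le_normc (z : R[i]) : `|complex.Re z| <= normc z.
Proof. by case: z => u v /=; rewrite -sqrtr_sqr ler_wsqrtr// lerDl sqr_ge0. Qed.

Lemma Im_le_normc (z : R[i]) : `|complex.Im z| <= normc z.
Proof. by case: z => u v /=; rewrite -sqrtr_sqr ler_wsqrtr// lerDr sqr_ge0. Qed.

Lemma lp_complete (F : set_system (lp p1)) :
  ProperFilter F -> cauchy F -> cvg F.
Proof.
move=> FF /cauchy_ballP Fc.
have {}Fc (e : R) : 0 < e ->
    \forall x & y \near F, (lpnorm p ((x : lp p1) - y : lp p1)%R < e%:E)%E.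
  move=> e0; have ec : 0 < e%:C by rewrite (ltcR 0).
  by have := Fc _ ec; apply: filterS => -[x y] /=; rewrite lp_ballE.
have coord_cvg (T : R[i] -> R) : {morph T : x y / x - y} ->
    (forall z, `|T z| <= normc z) -> forall k, cvg ((fun x : lp p1 => T (x k)) @ F).
  move=> TB Tn k; apply: cauchy_cvg; apply/cauchy_ballP => e e0.
  rewrite near_simpl; near_simpl; have := Fc _ e0.
  apply: filterS => -[x y] /= xy.
  rewrite -ball_normE /ball_/= -TB (le_lt_trans (Tn _))// -lte_fin.
  exact: le_lt_trans (lpnorm_coord (x - y) k) xy.
pose l k : R[i] := lim ((fun x : lp p1 => complex.Re (x k)) @ F) +i*
                   lim ((fun x : lp p1 => complex.Im (x k)) @ F).
have ReB : {morph @complex.Re R : u v / u - v} by move=> [? ?] [? ?].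
have ImB : {morph @complex.Im R : u v / u - v} by move=> [? ?] [? ?].
have lE k (d : R) : 0 < d -> \forall x \near F, normc ((x : lp p1) k - l k) <= d.
  move=> d0; have d20 : 0 < d / 2 by rewrite divr_gt0.
  have /cvgrPdist_le/(_ _ d20) Rex := coord_cvg _ ReB Re_le_normc k.
  have /cvgrPdist_le/(_ _ d20) Imx := coord_cvg _ ImB Im_le_normc k.
  near=> x; rewrite (le_trans (normc_le_ReIm _))// [leRHS]splitr lerD//.
  - by rewrite ReB distrC; near: x.
  - by rewrite ImB distrC; near: x.
have lEN N (d : R) : 0 < d ->
    \forall x \near F, forall k, (k < N)%N -> normc ((x : lp p1) k - l k) <= d.
  move=> d0; elim: N => [|N IH]; first exact: nearW.
  near=> x => k; rewrite ltnS leq_eqVlt => /predU1P[->|]; first by near: x; exact: lE.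
  by move: k; near: x.
have lpl (e : R) : 0 < e ->
    \forall x \near F, (lpnorm p (lpseq (x : lp p1) - l)%R <= e%:E)%E.
  move=> e0; have e20 : 0 < e / 2 by rewrite divr_gt0.
  apply: filterS (nearP_dep (Fc _ e20)) => x Fx.
  apply: lpN_ub_trunc => //; first exact: ltW.
  move=> N; pose one k : R := if (k < N)%N then 1 else 0.
  have one_lty := lpN_trunc_lt p1 (fun=> 1) N.
  have one_fin : ('N[@counting nat R]_(p%:E)[EFin \o one])%E \is a fin_num.
    by rewrite ge0_fin_numE ?Lnorm_ge0.
  set M := fine ('N[@counting nat R]_(p%:E)[EFin \o one])%E.
  have M0 : 0 <= M by rewrite fine_ge0 ?Lnorm_ge0.
  pose d := e / 2 / (M + 1).
  have d0 : 0 < d by rewrite divr_gt0// ltr_wpDl.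
  have [y [xy yl]] := filter_ex (filterI Fx (lEN N d d0)).
  pose h k : R := normc ((x - y : lp p1) k) + d * one k.
  apply: (@le_trans _ _ ('N[@counting nat R]_(p%:E)[EFin \o h])%E).
    apply: lpN_le => // k /=; rewrite [leRHS]ger0_norm; last first.
      rewrite /h addr_ge0 ?normc_ge0// mulr_ge0 ?(ltW d0)// /one.
      by case: ifP.
    rewrite /h /one; case: ifPn => kN.
      rewrite mulr1 ger0_norm ?normc_ge0//.
      rewrite (_ : (lpseq x - l) k = (x k - y k) + (y k - l k)); last by rewrite addrA subrK.
      by rewrite (le_trans (normcD _ _))// lerD2l; exact: yl.
    by rewrite normr0 mulr0 addr0 normc_ge0.
  apply: le_trans (lpND p1 _ _) _.
  rewrite [e]splitr EFinD; apply: leeD; first exact: ltW.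
  rewrite lpNZ// -(fineK one_fin) -/M -EFinM lee_fin ger0_norm ?(ltW d0)//.
  by rewrite /d mulrAC ler_pdivrMr ?ltr_wpDl// ler_wpM2l ?(ltW e20)// lerDl.
have lin : l \in lp_pred.
  have [x xl] := filter_ex (lpl 1 ltr01).
  have -> : l = (lpseq x) - ((lpseq x) - l).
    by rewrite opprB addrC subrK.
  apply: rpredB; first exact: lpP.
  by rewrite unfold_in/= (le_lt_trans xl)// ltry.
apply/cvg_ex; exists (Lp p1 lin); apply/cvgrPdist_le => e e0.
have eE : e = (complex.Re e)%:C by rewrite RRe_real// gtr0_real.
have e'0 : 0 < complex.Re e by rewrite -ltcR -eE.
apply: filterS (lpl _ e'0) => x xl.
rewrite distrC eE lp_normE lecR -lee_fin.
by rewrite (fineK (lpnorm_fin (x - Lp p1 lin))).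
Unshelve. all: by end_near. Qed.

HB.instance Definition _ := Uniform_isComplete.Build (lp p1) lp_complete.

End lp_space.

Section bases.
Context {R : realType} {X : completeNormedModType R[i]}.
Implicit Types (p : R) (g : nat -> X) (alpha : nat -> R[i]).

Definition schauder_basis g := forall x : X,
  exists! alpha : nat -> R[i], series (fun n => alpha n *: g n) @ \oo --> x.

Definition c00 : set (nat -> R[i]) :=
  [set alpha | finite_set [set j | alpha j != 0]].

(* On c00 the value of lpnorm is finite (see c00_lp), so that fine loses
   nothing; _%:C embeds R in R[i], in which the norm of X takes its values. *)
Definition hilbertian p g := exists C : R, forall alpha, c00 alpha ->
  `|\sum_(j \in [set: nat]) alpha j *: g j| <= C%:C * (fine (lpnorm p alpha))%:C.

Definition besselian p g := exists2 c : R, 0 < c & forall alpha, c00 alpha ->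
  c%:C * (fine (lpnorm p alpha))%:C <= `|\sum_(j \in [set: nat]) alpha j *: g j|.

Definition riesz p g := hilbertian p g /\ besselian p g.

Lemma c00_lp p alpha : 1 <= p -> c00 alpha -> (lpnorm p alpha < +oo)%E.
Proof.
move=> p1 /finite_seqP[s sE].
have lt_max j : j \in s -> (j < (\max_(i <- s) i).+1)%N.
  by move=> js; rewrite ltnS; exact: leq_bigmax_seq.
apply: le_lt_trans (lpN_trunc_lt p1 (@normc R \o alpha) (\max_(i <- s) i).+1).
apply: lpN_le => // k /=; case: ifPn => // kN.
have [->|ak] := eqVneq (alpha k) 0; first by rewrite normc0.
have : [set j | alpha j != 0] k by [].
by rewrite sE => /lt_max; rewrite (negbTE kN).
Qed.

End bases.

(* Main.v *)
(** The bases are the rescaled unit vectors r_n e_n with r_n <> 0; nothing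
    requires them to be bounded above or away from 0 in norm. The sum of the
    a_n r_n e_n has norm |(a_n r_n)|_p, so such a basis is p-Hilbertian when
    0 <= r_n <= 1 and p-Besselian when r_n >= 1, while testing on a = e_n shows
    that it is not p-Hilbertian if r is unbounded and not p-Besselian if
    inf r = 0. The three parts use r_n = 1/(n+1), r_n = n+1, and the
    alternation of these two. *)

Require Import Defs.
From HB Require Import structures.
From mathcomp Require Import all_boot all_order all_algebra.
From mathcomp Require Import all_classical all_reals all_analysis.
From mathcomp Require Import complex.
Import Order.TTheory GRing.Theory Num.Theory.
Import numFieldNormedType.Exports.
Local Open Scope ring_scope.

Section WeightedUnitVectors.
Context {R : realType} {p : R} (p1 : 1 <= p).

Lemma unit_seq_c00 (n : nat) : c00 (fun k => (k == n)%:R : R[i]).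
Proof.
apply: (@sub_finite_set _ _ [set n]%classic); last exact: finite_set1.
by move=> k /=; case: (k =P n) => // _; rewrite eqxx.
Qed.

Definition unit_vec (n : nat) : lp p1 := Lp p1 (c00_lp p1 (unit_seq_c00 n)).

Variable r : nat -> R.

Definition wvec (n : nat) : lp p1 := (r n)%:C%C *: unit_vec n.

Lemma lpseq_sum (N : nat) (F : nat -> lp p1) (k : nat) :
  (\sum_(0 <= j < N) F j : lp p1) k = \sum_(0 <= j < N) F j k.
Proof. by elim/big_ind2: _ => // x1 x2 y1 y2 <- <-. Qed.

(** Serves both the finitely supported sums and the partial sums of a series. *)
Lemma sum_wvec (a : nat -> R[i]) (N k : nat) :
  (\sum_(0 <= j < N) a j *: wvec j : lp p1) k =
  if (k < N)%N then a k * (r k)%:C%C else 0.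
Proof.
rewrite lpseq_sum; under eq_bigr => j _.
  rewrite (_ : (a j *: wvec j) k = a j * ((r j)%:C%C * (k == j)%:R)) //.
  over.
rewrite /=; case: ifP => kN.
  rewrite (bigD1_seq k) ?mem_index_iota ?iota_uniq //= eqxx mulr1 big1 ?addr0 //.
  by move=> j /negPf; rewrite eq_sym => ->; rewrite !mulr0.
rewrite big_nat_cond big1 // => j; rewrite andbT => /andP[_ jN].
by case: eqVneq => [kj|]; [rewrite kj jN in kN|rewrite !mulr0].
Qed.

Lemma c00_bound {a : nat -> R[i]} : c00 a ->
  exists N : nat, forall k, (N <= k)%N -> a k = 0.
Proof.
move=> /finite_seqP[s sE]; exists (\max_(i <- s) i).+1 => k Nk.
apply/eqP/negP => /negP ak.
have : [set j | a j != 0]%classic k by [].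
rewrite sE => /= ks; have : (k <= \max_(i <- s) i)%N by exact: leq_bigmax_seq.
by rewrite leqNgt Nk.
Qed.

Lemma fsum_wvec (a : nat -> R[i]) : c00 a ->
  lpseq (\sum_(j \in [set: nat]) a j *: wvec j)%classic = fun k => a k * (r k)%:C%C.
Proof.
move=> /c00_bound[N aN].
(* The terms from [N] on vanish, so the sum over all indices is an ordinary partial sum. *)
rewrite -(@fsbig_widen _ _ _ _ (`I_N)%classic) //; last first.
  by move=> k [_ /= /negP]; rewrite -leqNgt => /aN ->; rewrite scale0r.
rewrite -fsbig_ord -(big_mkord xpredT (fun j => a j *: wvec j)).
apply/funext => k; rewrite sum_wvec; case: ltnP => // /aN ->.
by rewrite mul0r.
Qed.

Lemma normc_realM (s : R) (z : R[i]) : 0 <= s ->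
  Normc.normc (z * s%:C%C) = Normc.normc z * s.
Proof.
by move=> s0; rewrite Normc.normcM /= expr0n addr0 sqrtr_sqr ger0_norm.
Qed.

Lemma lpnorm_le (a b : nat -> R[i]) :
  (forall k, Normc.normc (a k) <= Normc.normc (b k)) -> (lpnorm p a <= lpnorm p b)%E.
Proof.
by move=> ab; apply: (lpN_le p1) => k /=; rewrite !ger0_norm ?normc_ge0.
Qed.

Lemma wvec_hilbertian : (forall n, 0 <= r n <= 1) -> hilbertian p wvec.
Proof.
(* The constant 1 works: |a_k r_k| <= |a_k| for each k, and the norm is monotone in the moduli. *)
move=> r01; exists 1 => a a0; rewrite lp_normE -rmorphM /= mul1r lecR.
rewrite fine_le ?lpnorm_fin // ?ge0_fin_numE ?lpnorm_ge0 ?(c00_lp p1 a0) //.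
rewrite fsum_wvec //; apply: lpnorm_le => k.
by have /andP[r0 r1] := r01 k; rewrite normc_realM // ler_piMr // normc_ge0.
Qed.

Lemma wvec_besselian : (forall n, 1 <= r n) -> besselian p wvec.
Proof.
move=> r1; exists 1 => // a a0; rewrite lp_normE -rmorphM /= mul1r lecR.
rewrite fine_le ?lpnorm_fin // ?ge0_fin_numE ?lpnorm_ge0 ?(c00_lp p1 a0) //.
rewrite fsum_wvec //; apply: lpnorm_le => k.
by rewrite normc_realM ?(le_trans ler01) // ler_peMr // normc_ge0.
Qed.

(** The n-th coordinate already contributes 1. Positivity lets this factor be cancelled when testing
    on e_n. *)
Lemma norm_unit_vec_gt0 (n : nat) : 0 < fine (lpnorm p (unit_vec n)).
Proof.
apply: lt_le_trans ltr01 _; rewrite -lee_fin fineK ?lpnorm_fin //.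
apply: le_trans (lpnorm_coord p1 _ n).
by rewrite /= eqxx /= expr1n expr0n addr0 sqrtr1.
Qed.

(** Here e_n plays two roles: as a coefficient sequence it selects the single term [wvec n], whose
    norm is |r_n| times that of the vector e_n. *)
Lemma norm_fsum_unit (n : nat) : 0 <= r n ->
  `|\sum_(j \in [set: nat]) unit_vec n j *: wvec j|%classic =
  (r n * fine (lpnorm p (unit_vec n)))%:C%C.
Proof.
move=> r0.
have -> : (\sum_(j \in [set: nat]) unit_vec n j *: wvec j)%classic = wvec n.
  apply/val_inj/funext => k /=; rewrite fsum_wvec; last exact: unit_seq_c00.
  rewrite [RHS](_ : _ = (r n)%:C%C * (k == n)%:R) //= mulrC.
  by case: eqVneq => [->//|_]; rewrite !mulr0.
by rewrite normrZ lp_normE normc_norm /= expr0n addr0 sqrtr_sqr ger0_norm // rmorphM.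
Qed.

Lemma wvec_not_hilbertian : (forall C, exists2 n, 0 <= r n & C < r n) ->
  ~ hilbertian p wvec.
Proof.
move=> rC [C]; have [n r0 rn] := rC C.
move=> /(_ _ (unit_seq_c00 n)); rewrite norm_fsum_unit // -rmorphM lecR.
by rewrite ler_pM2r ?norm_unit_vec_gt0 // leNgt rn.
Qed.

Lemma wvec_not_besselian : (forall c, 0 < c -> exists2 n, 0 <= r n & r n < c) ->
  ~ besselian p wvec.
Proof.
move=> rc [c c0]; have [n r0 rn] := rc c c0.
move=> /(_ _ (unit_seq_c00 n)); rewrite norm_fsum_unit // -rmorphM lecR.
by rewrite ler_pM2r ?norm_unit_vec_gt0 // leNgt rn.
Qed.

(** The p-th power of this norm is a tail of the convergent series of the |x_k|^p, hence tends to
    0. *)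
Lemma lpnorm_tail (x : lp p1) (e : R) : 0 < e ->
  \forall N \near \oo%classic,
    (lpnorm p (fun k => if (k < N)%N then 0%R else x k) <= e%:E)%E.
Proof.
move=> e0; pose t k := Normc.normc (x k) `^ p.
have t0 k : 0 <= t k by exact: powR_ge0.
have tlt : (\sum_(0 <= k <oo) (t k)%:E < +oo)%E.
  have := lpN_pow p1 (Normc.normc (R:=R) \o x).
  rewrite -/(lpnorm p x) -(fineK (lpnorm_fin x)) poweR_EFin => tE.
  rewrite (eq_eseriesr (g := fun k => (`|(Normc.normc (R:=R) \o x) k| `^ p)%:E)).
    by rewrite -tE ltry.
  by move=> k _ /=; rewrite ger0_norm ?normc_ge0.
have ep : 0 < e `^ p by rewrite powR_gt0.
have tge0 k : xpredT k -> (0 <= (t k)%:E)%E by rewrite lee_fin.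
have /fine_cvgP[tfin /cvgrPdist_lt /(_ _ ep) tcvg] := nneseries_tail_cvg tlt tge0.
near=> N; apply: (lpN_ub p1); first exact: ltW.
move=> M; set f := (X in \sum_(0 <= k < M) X k).
have fE k : f k = if (k < N)%N then 0 else t k.
  rewrite /f /=; case: ifP => _; last by rewrite ger0_norm ?normc_ge0.
  by rewrite Normc.normc0 normr0 powR0 // gt_eqF // (lt_le_trans _ p1).
under eq_bigr do rewrite fE.
have [MN|NM] := leqP M N.
  rewrite big_nat_cond big1 ?powR_ge0 // => k; rewrite andbT => /andP[_ kM].
  by rewrite (leq_trans kM MN).
rewrite (big_cat_nat (leq0n N) (ltnW NM)) /= big_nat_cond big1 ?add0r; last first.
  by move=> k; rewrite andbT => /andP[_ ->].
have -> : \sum_(N <= k < M) (if (k < N)%N then 0 else t k) = \sum_(N <= k < M) t k.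
  by apply: eq_big_nat => k /andP[Nk _]; rewrite ltnNge Nk.
have tN : (\sum_(N <= k <oo) (t k)%:E)%E \is a fin_num by near: N.
have : `|0 - fine (\sum_(N <= k <oo) (t k)%:E)%E| < e `^ p by near: N.
rewrite sub0r normrN => /ltW te.
(* The terms are nonnegative, so the block from [N] to [M] is at most the whole tail. *)
rewrite (le_trans _ te) // (le_trans _ (ler_norm _)) // -lee_fin fineK //.
by rewrite -sumEFin; apply: nneseries_lim_ge => k _ _; rewrite lee_fin.
Unshelve. all: by end_near. Qed.

(** Existence: the partial sums with coefficients x_k / r_k are the truncations of x, so the error
    is a tail. Uniqueness: coordinates are continuous, and the k-th one of the partial sums is
    eventually b_k r_k. *)
Lemma wvec_schauder : (forall n, r n != 0) -> schauder_basis wvec.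
Proof.
move=> r0 x; have rC0 n : (r n)%:C%C != 0 by rewrite (inj_eq (@complexI R)).
exists (fun k => x k / (r k)%:C%C); split.
  apply/cvgrPdist_le => e e0.
  (* A positive element of [R[i]] is real, so the estimate reduces to one in [R]. *)
  have eE : e = (complex.Re e)%:C%C by rewrite RRe_real// gtr0_real.
  have e'0 : 0 < complex.Re e by rewrite -ltcR -eE.
  apply: filterS (lpnorm_tail x _ e'0) => N xN.
  rewrite eE lp_normE lecR -lee_fin fineK ?lpnorm_fin //.
  rewrite (_ : lpseq _ = fun k => if (k < N)%N then 0 else x k) //.
  apply/funext => k.
  rewrite (_ : lpseq (x - _) k = x k - (series (fun n => (x n / (r n)%:C%C) *: wvec n) N) k) //.
  rewrite sum_wvec; case: ifP => _; last by rewrite subr0.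
  by rewrite divfK // subrr.
move=> b xb; apply/funext => k; apply: (mulIf (rC0 k)); rewrite divfK //.
apply/eqP; rewrite -subr_eq0; apply/eqP/Normc.eq0_normc/eqP.
rewrite eq_le normc_ge0 andbT; apply/ler_addgt0Pr => e e0; rewrite add0r.
have ec0 : 0 < e%:C%C by rewrite (ltcR 0).
(* The index [maxn N k.+1] is late enough for the error to be at most [e] and for the partial sum to
   contain the k-th term. *)
move/cvgrPdist_le : xb => /(_ _ ec0) [N _ /(_ (maxn N k.+1) (leq_maxl _ _))] /=.
rewrite lp_normE lecR -lee_fin fineK ?lpnorm_fin // => xe.
rewrite -lee_fin; apply: le_trans xe.
apply: le_trans (lpnorm_coord p1 _ k).
rewrite (_ : lpseq (x - _) k = x k - (series (fun n => b n *: wvec n) (maxn N k.+1)) k) //.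
by rewrite sum_wvec leq_maxr.
Qed.

End WeightedUnitVectors.

Theorem proposition4p7 (R : realType) (p : R) (hp : 1 < p) :
  (exists u : nat -> lp (ltW hp),
     [/\ schauder_basis u, hilbertian p u, ~ besselian p u & ~ riesz p u]) /\
  (exists v : nat -> lp (ltW hp),
     [/\ schauder_basis v, besselian p v & ~ hilbertian p v]) /\
  (exists w : nat -> lp (ltW hp),
     [/\ schauder_basis w, ~ hilbertian p w & ~ besselian p w]).
Proof.
(* The bound is stated for all m >= n so that the parity of m stays free for the alternating
   weights. *)
have big (C : R) : exists n : nat, forall m, (n <= m)%N -> C < m.+1%:R.
  exists (Num.bound `|C|) => m nm.
  apply: le_lt_trans (ler_norm C) _; apply: lt_le_trans (archi_boundP (normr_ge0 C)) _.
  by rewrite ler_nat ltnW.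
have small (c : R) : 0 < c -> exists n : nat, forall m, (n <= m)%N -> m.+1%:R^-1 < c.
  move=> c0; have [n cn] := big c^-1; exists n => m /cn cm.
  by rewrite invf_plt ?posrE.
have s0 (n : nat) : 0 <= n.+1%:R^-1 :> R by rewrite invr_ge0.
split; [|split].
- pose r n : R := n.+1%:R^-1.
  have nbes : ~ besselian p (wvec (ltW hp) r).
    by apply: wvec_not_besselian => c /small[n rn]; exists n; [exact: s0|exact: rn].
  exists (wvec (ltW hp) r); split=> //; last by case.
    by apply: wvec_schauder => n; rewrite invr_eq0 pnatr_eq0.
  by apply: wvec_hilbertian => n; rewrite s0 invf_le1 ?ler1n.
- pose r n : R := n.+1%:R.
  exists (wvec (ltW hp) r); split.
  + by apply: wvec_schauder => n; rewrite pnatr_eq0.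
  + by apply: wvec_besselian => n; rewrite ler1n.
  + by apply: wvec_not_hilbertian => C; have [n rn] := big C; exists n => //; exact: rn.
- pose r n : R := if odd n then n.+1%:R else n.+1%:R^-1.
  exists (wvec (ltW hp) r); split.
  + apply: wvec_schauder => n; rewrite /r.
    by case: odd; rewrite ?invr_eq0 pnatr_eq0.
  + apply: wvec_not_hilbertian => C; have [n rn] := big C.
    (* Odd indices carry the growing weights. *)
    exists n.*2.+1; rewrite /r /= odd_double //=.
    by apply: rn; rewrite -addnn leqW // leq_addr.
  + apply: wvec_not_besselian => c /small[n rn].
    (* Even indices carry the weights tending to 0. *)
    exists n.*2; rewrite /r odd_double //=.
    by apply: rn; rewrite -addnn leq_addr.
Qed.
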